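(* Suppose that each $K_k$, $1\le k\le n$, is reversible with respect to $\mu_k$, i.e. $\mu_k(g\,K_k(f))=\mu_k(f\,K_k(g))$ for all $f,g\in B(E)$, and that $\gamma>1$ satisfies $\overline g_{k-1,k}(x)\le\gamma$ for all $x\in E$ and $1\le k\le n$. Let $r\in\mathbb{N}=\{0,1,2,\dots\}$, $p=2^r$, and let $\rho\in(0,1)$ with $(1-\rho)\gamma^{p-1}<1$ be such that for all $1\le k\le n$ and $f\in B(E)$ $$\mathrm{Var}_{\mu_k}(K_k(f))\le(1-\rho)\,\mathrm{Var}_{\mu_k}(f).$$ Then for all $1\le j<k\le n$ and $f\in B(E)$, $$\|\hat q_{j,k}(f)\|_{L_p(\mu_j)}\le\delta(p)\,\|f\|_{L_p(\mu_k)}$$ with $$\delta(p)=\prod_{i=1}^r\frac{\gamma^{1-2^{-(i-1)}}}{(1-(1-\rho)\gamma^{2^i-1})^{2^{-i}}}<\frac{\gamma^{r-2+2^{-(r-1)}}}{1-(1-\rho)\gamma^{2^r-1}}$$ (an empty product being $1$).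
   Context: $E$ is a Polish space (complete separable metric space), $B(E)$ the bounded measurable real functions on $E$, $\mu(f)=\int f\,d\mu$, $\mathrm{Var}_\mu(f)=\mu(f^2)-\mu(f)^2$, $\|f\|_{L_p(\mu)}=\mu(|f|^p)^{1/p}$, and $K(f)(x)=\int f(z)K(x,dz)$ for a kernel $K$. $\mu_0,\dots,\mu_n$ are probability measures on $E$; for $1\le k\le n$, $K_k$ is a Markov transition kernel on $E$ with stationary distribution $\mu_k$ ($\mu_kK_k=\mu_k$), and $g_{k-1,k}\in B(E)$ is positive with $\mu_k(f)=\mu_{k-1}(g_{k-1,k}f)/\mu_{k-1}(g_{k-1,k})$ for all $f\in B(E)$. Put $\overline g_{k-1,k}=g_{k-1,k}/\mu_{k-1}(g_{k-1,k})$. Modified propagator: $\hat q_{k-1,k}(f)=K_{k-1}(\overline g_{k-1,k}f)$ for $2\le k\le n$ and $f\in B(E)$; $\hat q_{j,k}=\hat q_{j,j+1}\circ\cdots\circ\hat q_{k-1,k}$ for $1\le j<k\le n$; $\hat q_{k,k}(f)=f$. *)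

(* Defs.v *)
From HB Require Import structures.
From mathcomp Require Import all_boot all_order all_algebra.
From mathcomp Require Import all_classical all_reals all_analysis.

Set Implicit Arguments.
Unset Strict Implicit.
Unset Printing Implicit Defensive.

Import Order.TTheory GRing.Theory Num.Theory.
Import numFieldNormedType.Exports.

Local Open Scope classical_set_scope.
Local Open Scope ring_scope.

HB.mixin Record isSeparable T & Topological T := {
  separableT : exists2 D : set T, countable D & dense D
}.

(* The base point required by the library's measurable types is no restriction:
   a space that carries a probability measure is nonempty. *)
#[short(type="polishType")]
HB.structure Definition Polish (R : numDomainType) :=
  {T of Pointed T & Metric R T & Complete T & isSeparable T}.

Notation borel E := (g_sigma_algebraType (@open E)).

Definition bounded_meas d (T : measurableType d) (R : realType) :
    set (T -> R) :=
  [set f | measurable_fun setT f /\ bounded_fun (f : T -> R^o)].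

Definition kernel_app d (T : measurableType d) (R : realType)
    (K : R.-pker T ~> T) (f : T -> R) : T -> R :=
  fun x => \int[K x]_z f z.

Definition stationary d (T : measurableType d) (R : realType)
    (mu : probability T R) (K : R.-pker T ~> T) : Prop :=
  forall A : set T, measurable A -> (\int[mu]_x K x A = mu A)%E.

Definition reversible d (T : measurableType d) (R : realType)
    (mu : probability T R) (K : R.-pker T ~> T) : Prop :=
  forall f h : T -> R, bounded_meas f -> bounded_meas h ->
    \int[mu]_x (h x * kernel_app K f x) = \int[mu]_x (f x * kernel_app K h x).

(* Here and below [g k] stands for $g_{k-1,k}$, so only [k >= 1] is relevant. *)
Definition gbar d (T : measurableType d) (R : realType)
    (mu : nat -> probability T R) (g : nat -> T -> R) (k : nat) : T -> R :=
  fun x => g k x / \int[mu k.-1]_z g k z.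

Definition qhat_step d (T : measurableType d) (R : realType)
    (mu : nat -> probability T R) (K : nat -> R.-pker T ~> T)
    (g : nat -> T -> R) (k : nat) (f : T -> R) : T -> R :=
  kernel_app (K k.-1) (fun x => gbar mu g k x * f x).

(* $\hat q_{j,j+1} \circ \dots \circ \hat q_{k-1,k}$, the identity if j = k *)
Definition qhat d (T : measurableType d) (R : realType)
    (mu : nat -> probability T R) (K : nat -> R.-pker T ~> T)
    (g : nat -> T -> R) (j k : nat) : (T -> R) -> (T -> R) :=
  \big[(fun a b => a \o b) / idfun]_(j.+1 <= i < k.+1) qhat_step mu K g i.

(* $\delta(p)$ for $p = 2^r$ *)
Definition delta (R : realType) (gamma rho : R) (r : nat) : R :=
  \prod_(1 <= i < r.+1)
    (gamma `^ (1 - 2 `^ (- (i%:R - 1))) /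
     (1 - (1 - rho) * gamma ^+ (2 ^ i - 1)) `^ (2 `^ (- i%:R))).

(* Main.v *)
(** Fix [f] and write [a_i] for the p-th moment under [mu_i] of [f_i = qhat_{i,k} f],
    where [p = 2q].  Since [f_i = K_i (gbar f_{i+1})], Jensen's inequality and the
    spectral gap applied to [|gbar f_{i+1}|^q] give, with [c = (1-rho) gamma^(p-1)],
      [a_i <= c a_{i+1} + rho gamma^(p-2) mu_{i+1}(|f_{i+1}|^q)^2].
    By induction on [r] the last moment is at most [delta(q)^q mu_k(|f|^q)], whose
    square is at most [delta(q)^p a_k]; hence [a_i <= B a_k / (1 - c)] with
    [B = gamma^(p-2) delta(q)^p] follows by descending induction on [i], and
    [B / (1 - c) = delta(p)^p].  The case [p = 1] is stationarity of [mu_i]. *)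
From HB Require Import structures.
Require Import Defs.
From mathcomp Require Import all_boot all_order all_algebra.
From mathcomp Require Import all_classical all_reals all_analysis.
From mathcomp Require Import measurable_realfun zify ring lra.

Set Implicit Arguments.
Unset Strict Implicit.

Import Order.TTheory GRing.Theory Num.Theory.
Import numFieldNormedType.Exports.

Local Open Scope classical_set_scope.
Local Open Scope ring_scope.

(** * Integrals, variances and L_p norms of bounded measurable functions *)

Section bounded_measurable.
Context {d} {T : measurableType d} {R : realType}.
Implicit Types (f h : T -> R) (P : probability T R).

Lemma bounded_measP f : bounded_meas f <->
  measurable_fun setT f /\ exists M : R, forall x, `|f x| <= M.
Proof.
split=> -[mf [M fM]]; split=> //.
  (* [bounded_fun] bounds [|f|] by every real strictly above [M], hence [M + 1]. *)
  case: fM => Mreal fM; exists (M + 1) => x.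
  by apply: fM => //; rewrite ltrDl.
exists M; split; first exact: num_real.
by move=> N MN x _ /=; rewrite (le_trans (fM x))// ltW.
Qed.

Lemma bounded_measM f h :
  bounded_meas f -> bounded_meas h -> bounded_meas (fun x => f x * h x).
Proof.
move=> /bounded_measP[mf [M fM]] /bounded_measP[mh [N hN]]; apply/bounded_measP.
split; first exact: measurable_funM.
by exists (M * N) => x; rewrite normrM ler_pM.
Qed.

Lemma bounded_meas_normX f n :
  bounded_meas f -> bounded_meas (fun x => `|f x| ^+ n).
Proof.
move=> /bounded_measP[mf [M fM]]; apply/bounded_measP; split.
  by apply: measurable_funX; exact: measurableT_comp.
by exists (M ^+ n) => x; rewrite normrX normr_id lerXn2r ?nnegrE ?(le_trans _ (fM x)).
Qed.

Lemma bounded_meas_norm f : bounded_meas f -> bounded_meas (fun x => `|f x|).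
Proof. exact: (bounded_meas_normX 1). Qed.

Lemma bounded_meas_integrable P f :
  bounded_meas f -> P.-integrable setT (EFin \o f).
Proof.
move=> [mf bf]; apply: measurable_bounded_integrable => //.
by rewrite (le_lt_trans (probability_le1 _ _))// ltry.
Qed.

Lemma le_Rintegral_bounded_meas P f h : bounded_meas f -> bounded_meas h ->
  (forall x, f x <= h x) -> \int[P]_x f x <= \int[P]_x h x.
Proof. by move=> bf bh fh; apply: le_Rintegral => //; exact: bounded_meas_integrable. Qed.

Lemma RintegralZl_bounded_meas P (c : R) f : bounded_meas f ->
  \int[P]_x (c * f x) = c * \int[P]_x f x.
Proof. by move=> bf; apply: RintegralZl => //; exact: bounded_meas_integrable. Qed.

Lemma Rintegral_probability_cst P (c : R) : \int[P]_x c = c.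
Proof. by rewrite Rintegral_cst// [X in fine X]probability_setT mulr1. Qed.

Lemma normr_Rintegral_le_bound P f (M : R) : bounded_meas f ->
  (forall x, `|f x| <= M) -> `|\int[P]_x f x| <= M.
Proof.
move=> bf fM; rewrite (le_trans (le_normr_Rintegral _ _))//.
  exact: bounded_meas_integrable.
rewrite -[leRHS](Rintegral_probability_cst P); apply: le_Rintegral_bounded_meas => //.
  exact: bounded_meas_norm.
apply/bounded_measP; split; first exact: measurable_cst.
by exists `|M|.
Qed.

Lemma variance_bounded_meas P f : bounded_meas f ->
  variance P f = (\int[P]_x f x ^+ 2 - (\int[P]_x f x) ^+ 2)%:E.
Proof.
move=> bf.
have bff : bounded_meas (fun x => f x ^+ 2) by exact: bounded_measM.
have L1 h : bounded_meas h -> h \in Lfun P 1.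
  by move=> bh; apply/Lfun1_integrable; exact: bounded_meas_integrable.
have EE h : bounded_meas h -> expectation P h = (\int[P]_x h x)%:E.
  move=> bh; rewrite unlock /Rintegral fineK//.
  by apply: integrable_fin_num => //; exact: bounded_meas_integrable.
rewrite /variance covarianceE; [|exact: L1|exact: L1|exact: (L1 _ bff)].
by rewrite (EE _ bff) !EE.
Qed.

Lemma sqr_Rintegral_le P f : bounded_meas f ->
  (\int[P]_x f x) ^+ 2 <= \int[P]_x f x ^+ 2.
Proof.
by move=> bf; rewrite -subr_ge0 -lee_fin -variance_bounded_meas// variance_ge0.
Qed.

(** Jensen's inequality by repeated squaring: square the bound for [2 ^ s], then use that the
    variance of [|f| ^+ (2 ^ s)] is nonnegative. *)
Lemma Rintegral_normX_le P f s : bounded_meas f ->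
  `|\int[P]_x f x| ^+ (2 ^ s) <= \int[P]_x `|f x| ^+ (2 ^ s).
Proof.
move=> bf; elim: s => [|s ih].
  rewrite expn0 expr1; under [leRHS]eq_Rintegral do rewrite expr1.
  by apply: le_normr_Rintegral => //; exact: bounded_meas_integrable.
have int_ge0 : 0 <= \int[P]_x `|f x| ^+ (2 ^ s).
  by apply: Rintegral_ge0 => x _; exact: exprn_ge0.
rewrite expnSr exprM (le_trans (lerXn2r 2 _ _ ih)) ?nnegrE ?exprn_ge0//.
rewrite (le_trans (sqr_Rintegral_le _ (bounded_meas_normX _ bf)))//.
by under eq_Rintegral do rewrite -exprM.
Qed.

Lemma Lnorm_bounded_meas P f n : (0 < n)%N -> bounded_meas f ->
  ('N[P]_(n%:R%:E)[EFin \o f] = ((\int[P]_x `|f x| ^+ n) `^ n%:R^-1)%:E)%E.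
Proof.
move=> n0 bf; rewrite unlock /Rintegral -poweR_EFin fineK.
  by congr (_ `^ _)%E; apply: eq_integral => x _ /=; rewrite powR_mulrn.
apply: integrable_fin_num => //.
exact: (bounded_meas_integrable P (bounded_meas_normX _ bf)).
Qed.

End bounded_measurable.

(** * Markov kernels acting on bounded functions *)

Section kernel_app.
Context {d} {T : measurableType d} {R : realType} (K : R.-pker T ~> T).
Implicit Types f : T -> R.

(* [K x] with the probability structure that the library does not infer for it. *)
Definition pker_at (x : T) : set T -> \bar R := K x.

HB.instance Definition _ x := Measure.copy (pker_at x) (K x).
HB.instance Definition _ x :=
  Measure_isProbability.Build _ _ _ (pker_at x) (prob_kernel x).

Lemma pker_atE x : K x = pker_at x :> {measure set T -> \bar R}.
Proof. exact: eq_measure. Qed.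

Lemma bounded_meas_kernel_app f :
  bounded_meas f -> bounded_meas (kernel_app K f).
Proof.
move=> bf; apply/bounded_measP; split; last first.
  have /bounded_measP[_ [M fM]] := bf; exists M => x.
  by rewrite /kernel_app pker_atE; exact: normr_Rintegral_le_bound.
(* The extended-real integral is split into positive and negative parts, since measurability of
   kernel integrals is stated for nonnegative integrands. *)
apply: (measurableT_comp (f := fine)) => //.
under eq_fun do rewrite integralE.
have mf : measurable_fun setT (EFin \o f) by apply/measurable_EFinP; case: bf.
apply: emeasurable_funB; apply: measurable_fun_integral_kernel => //.
- by move=> U mU; exact: measurable_kernel.
- exact: measurable_funepos.
- by move=> U mU; exact: measurable_kernel.
- exact: measurable_funeneg.
Qed.

Lemma kernel_app_normX_le f s x : bounded_meas f ->
  `|kernel_app K f x| ^+ (2 ^ s) <= kernel_app K (fun z => `|f z| ^+ (2 ^ s)) x.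
Proof.
by move=> bf; rewrite /kernel_app pker_atE; exact: Rintegral_normX_le.
Qed.

(** Stationarity on sets says that the composite measure mu K is mu. With mu viewed as a constant
    kernel [l] from a one-point space, the left side is an integral against the composition of [l]
    and [K]. *)
Lemma Rintegral_kernel_app (mu : probability T R) f :
  stationary mu K -> bounded_meas f -> (forall x, 0 <= f x) ->
  \int[mu]_x kernel_app K f x = \int[mu]_x f x.
Proof.
move=> muK bf f0.
pose l : R.-pker unit ~> T :=
  kprobability (measurable_cst (mu : pprobability T R)).
have mf : measurable_fun setT (EFin \o f) by apply/measurable_EFinP; case: bf.
congr fine; transitivity (\int[mu]_x \int[K x]_z (f z)%:E)%E.
  apply: eq_integral => x _; rewrite /kernel_app pker_atE /Rintegral fineK//.
  by apply: integrable_fin_num => //; exact: bounded_meas_integrable.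
transitivity (\int[kcomp l (kernel.kernel_snd K) tt]_x (f x)%:E)%E.
  by rewrite integral_kcomp.
by apply: eq_measure_integral => A mA _; exact: muK.
Qed.

End kernel_app.

(** * Moment bounds for one step of the propagator *)

Section one_step.
Context {d} {T : measurableType d} {R : realType} (K : R.-pker T ~> T).
Variables (mu nu : probability T R) (G : T -> R) (gamma : R).
Hypothesis muK : stationary mu K.
Hypotheses (bG : bounded_meas G) (G_ge0 : forall x, 0 <= G x).
Hypothesis nuE : forall f, bounded_meas f ->
  \int[nu]_x f x = \int[mu]_x (G x * f x).
Implicit Types f : T -> R.

(** This becomes [qhat_step] at index [j.+1] when [mu], [nu], [K], [G] are [mu j], [mu j.+1], [K j]
    and [gbar] at [j.+1]. *)
Let q f := kernel_app K (fun x => G x * f x).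

(** Pointwise |K(Gf)| <= K|Gf|; stationarity removes K and the density G turns mu into nu. *)
Lemma Rintegral_norm_step_le f : bounded_meas f ->
  \int[mu]_x `|q f x| <= \int[nu]_x `|f x|.
Proof.
move=> bf; have bGf := bounded_measM bG bf.
rewrite nuE; last exact: bounded_meas_norm.
rewrite (_ : \int[mu]_x (G x * _) = \int[mu]_x `|G x * f x|); last first.
  by apply: eq_Rintegral => x _; rewrite normrM ger0_norm.
have bn := bounded_meas_norm bGf.
rewrite -[leRHS](Rintegral_kernel_app muK)//.
apply: le_Rintegral_bounded_meas => //.
- exact/bounded_meas_norm/bounded_meas_kernel_app.
- exact: bounded_meas_kernel_app.
- by move=> x; exact: (kernel_app_normX_le K 0 x bGf).
Qed.

Hypothesis G_le : forall x, G x <= gamma.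

(** Of the n factors G, n - 1 are bounded by gamma and the last one is kept to change mu into nu. *)
Lemma Rintegral_weight_normX_le f n : (0 < n)%N -> bounded_meas f ->
  \int[mu]_x `|G x * f x| ^+ n <= gamma ^+ n.-1 * \int[nu]_x `|f x| ^+ n.
Proof.
case: n => // n _ bf; have bfn := bounded_meas_normX n.+1 bf.
rewrite nuE// -RintegralZl_bounded_meas; last exact: bounded_measM.
apply: le_Rintegral_bounded_meas.
- exact/bounded_meas_normX/bounded_measM.
- apply/bounded_measP; have /bounded_measP[mGf [M GfM]] := bounded_measM bG bfn.
  split; first exact: measurable_funM.
  exists (`|gamma ^+ n| * M) => x.
  by rewrite normrM ler_wpM2l.
- move=> x; rewrite normrM exprMn (ger0_norm (G_ge0 x)) exprSr -mulrA.
  by rewrite ler_wpM2r ?mulr_ge0// lerXn2r ?nnegrE// (le_trans (G_ge0 x)).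
Qed.

Variable rho : R.
Hypotheses (rho_ge0 : 0 <= rho) (rho_le1 : rho <= 1).
Hypothesis gap : forall f, bounded_meas f ->
  (variance mu (kernel_app K f) <= (1 - rho)%:E * variance mu f)%E.

Lemma Rintegral_normX_step_le f s : bounded_meas f ->
  \int[mu]_x `|q f x| ^+ (2 ^ s.+1) <=
    (1 - rho) * gamma ^+ (2 ^ s.+1 - 1) * \int[nu]_x `|f x| ^+ (2 ^ s.+1) +
    rho * gamma ^+ (2 ^ s.+1 - 2) * (\int[nu]_x `|f x| ^+ (2 ^ s)) ^+ 2.
Proof.
move=> bf; have bGf := bounded_measM bG bf.
pose u x := `|G x * f x| ^+ (2 ^ s).
have bu : bounded_meas u by exact: bounded_meas_normX.
have u_ge0 x : 0 <= u x by exact: exprn_ge0.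
have bKu := bounded_meas_kernel_app K bu.
have two_gt0 m : (0 < 2 ^ m)%N by rewrite expn_gt0.
have int_ge0 m : 0 <= \int[nu]_x `|f x| ^+ m.
  by apply: Rintegral_ge0 => x _; exact: exprn_ge0.
have gamma_ge0 : 0 <= gamma by rewrite (le_trans (G_ge0 point)).
(* Since mu(Ku) = mu(u), the gap rearranges to mu((Ku)^2) <= (1 - rho) mu(u^2) + rho mu(u)^2; [le2]
   and [le3] bound the two terms. *)
have := gap bu; rewrite !variance_bounded_meas// lee_fin Rintegral_kernel_app//.
have -> : \int[mu]_x u x ^+ 2 = \int[mu]_x `|G x * f x| ^+ (2 ^ s.+1).
  by apply: eq_Rintegral => x _; rewrite -exprM -expnSr.
move=> gapu.
have le1 : \int[mu]_x `|q f x| ^+ (2 ^ s.+1) <= \int[mu]_x kernel_app K u x ^+ 2.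
  apply: le_Rintegral_bounded_meas.
  - exact/bounded_meas_normX/bounded_meas_kernel_app.
  - exact: bounded_measM.
  - move=> x; rewrite expnSr exprM lerXn2r ?nnegrE ?exprn_ge0//.
      by apply: Rintegral_ge0 => z _.
    exact: kernel_app_normX_le.
have le2 := Rintegral_weight_normX_le (two_gt0 s.+1) bf.
have le3 : (\int[mu]_x u x) ^+ 2 <=
    gamma ^+ (2 ^ s.+1 - 2) * (\int[nu]_x `|f x| ^+ (2 ^ s)) ^+ 2.
  rewrite (_ : (2 ^ s.+1 - 2)%N = ((2 ^ s).-1 * 2)%N); last first.
    by rewrite expnSr -subn1 mulnBl mul1n.
  rewrite exprM -exprMn lerXn2r ?nnegrE ?mulr_ge0 ?exprn_ge0//.
    by apply: Rintegral_ge0 => x _.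
  exact: Rintegral_weight_normX_le.
rewrite -subn1 in le2.
have := ler_wpM2l rho_ge0 le3.
have /ler_wpM2l/(_ _ _ le2) : 0 <= 1 - rho by rewrite subr_ge0.
rewrite !mulrA; lra.
Qed.

End one_step.

(** * The constant delta(p): its recursion and its strict upper bound *)

Section delta.
Context {R : realType} (gamma rho : R).
Hypotheses (gamma_gt1 : 1 < gamma) (rho_lt1 : rho < 1).

(** The base of the i-th denominator in [delta]. It decreases in i, so positivity at r gives
    positivity at every smaller index. *)
Let x_ i := 1 - (1 - rho) * gamma ^+ (2 ^ i - 1).

Let gamma_gt0 : 0 < gamma. Proof. by rewrite (lt_trans _ gamma_gt1). Qed.

Let x_le i r : (i <= r)%N -> x_ r <= x_ i.
Proof.
move=> ir; have rho'_ge0 : 0 <= 1 - rho by rewrite subr_ge0 ltW.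
rewrite lerB// ler_wpM2l//.
by rewrite ler_weXn2l ?ltW// leq_sub2r// leq_exp2l.
Qed.

Let x_lt1 i : x_ i < 1.
Proof. by rewrite gtrBl mulr_gt0 ?subr_gt0// exprn_gt0. Qed.

Lemma powR2_oppn n : 2 `^ (- n%:R) = (2 ^ n)%:R^-1 :> R.
Proof. by rewrite powR_invn// natrX. Qed.

Lemma powR2_oppB1 n : 2 `^ (- (n%:R - 1)) = 2 / (2 ^ n)%:R :> R.
Proof.
by rewrite opprB powRB ?pnatr_eq0 ?implybT// powRr1// powR_mulrn// natrX.
Qed.

Lemma deltaS r : delta gamma rho r.+1 = delta gamma rho r *
  (gamma `^ (1 - (2 ^ r)%:R^-1) / x_ r.+1 `^ (2 ^ r.+1)%:R^-1).
Proof.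
rewrite /delta big_nat_recr//= powR2_oppB1 powR2_oppn.
rewrite (_ : 2 / (2 ^ r.+1)%:R = (2 ^ r)%:R^-1 :> R)//.
by rewrite expnS natrM; field; rewrite pnatr_eq0 expn_eq0.
Qed.

(** Raising to the power p = 2^(r+1) clears the roots of the new factor, leaving gamma^(p-2) / (1 -
    c) with c = (1 - rho) gamma^(p-1). *)
Lemma deltaX_S r : 0 < x_ r.+1 ->
  delta gamma rho r.+1 ^+ (2 ^ r.+1) =
  (delta gamma rho r ^+ (2 ^ r)) ^+ 2 * gamma ^+ (2 ^ r.+1 - 2) / x_ r.+1.
Proof.
move=> x0.
rewrite deltaS exprMn -mulrA -exprM -expnSr; congr (_ * _).
rewrite exprMn exprVn; congr (_ / _).
  rewrite -[LHS]powR_mulrn ?powR_ge0// -powRrM mulrBl mul1r expnS natrM.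
  rewrite [_^-1 * _]mulrC -mulrA mulfV// mulr1 -natrM -natrB ?powR_mulrn ?ltW//.
  by rewrite leq_pmulr// expn_gt0.
by rewrite -[LHS]powR_mulrn ?powR_ge0// -powRrM mulVf// powRr1// ltW.
Qed.

(** This starts the descending induction on the moments, where the propagator is the identity. *)
Lemma deltaX_ge1 r : 0 < x_ r -> 1 <= delta gamma rho r ^+ (2 ^ r).
Proof.
elim: r => [_|r ih x0]; first by rewrite /delta big_geq// expr1n.
have {}ih := ih (lt_le_trans x0 (x_le (leqnSn r))).
rewrite deltaX_S// ler_pdivlMr// mul1r (le_trans (ltW (x_lt1 _)))//.
by rewrite mulr_ege1// exprn_ege1// ltW.
Qed.

Lemma delta_lt r : 0 < x_ r ->
  delta gamma rho r < gamma `^ (r%:R - 2 + 2 `^ (- (r%:R - 1))) / x_ r.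
Proof.
move=> x0.
(* Each [x_ i] is replaced by the smaller [x_ r], so the exponents add up: 2^(-i) over 1 <= i <= s
   sums to 1 - 2^(-s), and 1 - 2^(-(i-1)) to s - 2 + 2^(-(s-1)). *)
have D s : (s <= r)%N -> delta gamma rho s <=
    gamma `^ (s%:R - 2 + 2 `^ (- (s%:R - 1))) / x_ r `^ (1 - (2 ^ s)%:R^-1).
  elim: s => [_|s ih sr].
    rewrite /delta big_geq// powR2_oppB1 expn0 invr1 mulr1 subrr sub0r addNr.
    by rewrite !powRr0 divr1.
  have s2 : (2 ^ s)%:R != 0 :> R by rewrite pnatr_eq0 expn_eq0.
  rewrite deltaS.
  have -> : s.+1%:R - 2 + 2 `^ (- (s.+1%:R - 1)) =
      (s%:R - 2 + 2 `^ (- (s%:R - 1))) + (1 - (2 ^ s)%:R^-1) :> R.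
    by rewrite !powR2_oppB1 expnS natrM -natr1; field.
  have -> : 1 - (2 ^ s.+1)%:R^-1 =
      (1 - (2 ^ s)%:R^-1) + (2 ^ s.+1)%:R^-1 :> R.
    by rewrite expnS natrM; field.
  have powRD_gt0 y u v : 0 < y -> y `^ (u + v) = y `^ u * y `^ v :> R.
    by move=> y0; rewrite powRD// (gt_eqF y0) implybT.
  rewrite [X in _ <= X / _]powRD_gt0// [X in _ <= _ / X]powRD_gt0//.
  rewrite invfM mulrACA ler_pM ?ih 1?ltnW//.
  - by apply: prodr_ge0 => i _; rewrite divr_ge0 ?powR_ge0.
  - by rewrite divr_ge0 ?powR_ge0.
  - rewrite ler_wpM2l ?powR_ge0// lef_pV2 ?posrE ?powR_gt0//.
      by rewrite ge0_ler_powR ?nnegrE ?invr_ge0 ?(ltW x0) ?x_le// ltW// (lt_le_trans x0) ?x_le.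
    by rewrite (lt_le_trans x0) ?x_le.
(* Strictness, also for r = 0, comes from 0 < [x_ r] < 1: its power 1 - 2^(-r) exceeds [x_ r]. *)
rewrite (le_lt_trans (D r (leqnn r)))// ltr_pM2l ?powR_gt0//.
rewrite ltf_pV2 ?posrE ?powR_gt0// powRB ?(gt_eqF x0) ?implybT//.
rewrite powRr1 ?(ltW x0)//.
rewrite ltr_pdivlMr ?powR_gt0// gtr_pMr//.
have := @gt0_ltr_powR R (2 ^ r)%:R^-1; rewrite invr_gt0 ltr0n expn_gt0 => /(_ isT).
by move=> /(_ (x_ r) 1); rewrite !nnegrE powR1 ler01 (ltW x0) x_lt1; exact.
Qed.

End delta.

(** * Iterating the one-step bounds along the propagator *)

Section chain.
Context {d} {T : measurableType d} {R : realType} (n : nat).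
Context (mu : nat -> probability T R) (K : nat -> R.-pker T ~> T).
Context (g : nat -> T -> R) (gamma : R).
Hypothesis g_bounded : forall k, (1 <= k <= n)%N -> bounded_meas (g k).
Hypothesis g_gt0 : forall k, (1 <= k <= n)%N -> forall x, 0 < g k x.
Hypothesis mu_g : forall k, (1 <= k <= n)%N -> forall f, bounded_meas f ->
  \int[mu k]_x f x =
  (\int[mu k.-1]_x (g k x * f x)) / (\int[mu k.-1]_x g k x).
Hypothesis gbar_le :
  forall k, (1 <= k <= n)%N -> forall x, gbar mu g k x <= gamma.
Implicit Types f : T -> R.

Lemma gbar_ge0 k x : (1 <= k <= n)%N -> 0 <= gbar mu g k x.
Proof.
move=> kn; apply: divr_ge0; first exact/ltW/g_gt0.
by apply: Rintegral_ge0 => z _; exact/ltW/g_gt0.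
Qed.

Lemma bounded_meas_gbar k : (1 <= k <= n)%N -> bounded_meas (gbar mu g k).
Proof.
move=> kn; apply/bounded_measP; split.
  by apply: measurable_funM => //; case: (g_bounded kn).
by exists gamma => x; rewrite ger0_norm ?gbar_ge0// gbar_le.
Qed.

Lemma Rintegral_gbarM k f : (1 <= k <= n)%N -> bounded_meas f ->
  \int[mu k]_x f x = \int[mu k.-1]_x (gbar mu g k x * f x).
Proof.
move=> kn bf; rewrite mu_g// mulrC -RintegralZl_bounded_meas.
  by apply: eq_Rintegral => x _; rewrite /gbar mulrA [_^-1 * _]mulrC.
by apply: bounded_measM => //; exact: g_bounded.
Qed.

Lemma qhat_id k f : qhat mu K g k k f = f.
Proof. by rewrite /qhat big_geq. Qed.

Lemma qhat_recl j k f : (j < k)%N ->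
  qhat mu K g j k f = qhat_step mu K g j.+1 (qhat mu K g j.+1 k f).
Proof. by move=> jk; rewrite /qhat big_ltn. Qed.

Lemma bounded_meas_qhat j m f : (j + m <= n)%N -> bounded_meas f ->
  bounded_meas (qhat mu K g j (j + m) f).
Proof.
move=> + bf; elim: m j => [|m ih] j jmn; first by rewrite addn0 qhat_id.
rewrite addnS qhat_recl ?ltnS ?leq_addr// -addSn.
apply: bounded_meas_kernel_app; apply: bounded_measM.
  by apply: bounded_meas_gbar; lia.
by apply: ih; lia.
Qed.

Variable rho : R.
Hypothesis K_stationary : forall k, (1 <= k <= n)%N -> stationary (mu k) (K k).
Hypothesis gamma_gt1 : 1 < gamma.
Hypotheses (rho_ge0 : 0 <= rho) (rho_lt1 : rho < 1).
Hypothesis K_gap : forall k, (1 <= k <= n)%N -> forall f, bounded_meas f ->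
  (variance (mu k) (kernel_app (K k) f) <= (1 - rho)%:E * variance (mu k) f)%E.

(** Writing k = j + m makes the descending induction on j an induction on m with j + m fixed; it is
    nested in the induction on r, whose hypothesis covers all j and m. *)
Lemma Rintegral_normX_qhat_le r j m f :
  (1 - rho) * gamma ^+ (2 ^ r - 1) < 1 -> (1 <= j)%N -> (j + m <= n)%N ->
  bounded_meas f ->
  \int[mu j]_x `|qhat mu K g j (j + m) f x| ^+ (2 ^ r) <=
  delta gamma rho r ^+ (2 ^ r) * \int[mu (j + m)]_x `|f x| ^+ (2 ^ r).
Proof.
move=> + + + bf; elim: r m j => [|r ihr] m j c_lt1 j1.
  rewrite /delta big_geq// mul1r; elim: m j j1 => [|m ih] j j1 jmn.
    by rewrite addn0 qhat_id.
  rewrite addnS qhat_recl ?ltnS ?leq_addr// -addSn.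
  have j1n : (1 <= j.+1 <= n)%N by lia.
  rewrite (le_trans _ (ih j.+1 _ _))//; last by lia.
  apply: Rintegral_norm_step_le.
  - by apply: K_stationary; lia.
  - exact: bounded_meas_gbar.
  - by move=> x; exact: gbar_ge0.
  - by move=> h bh; rewrite Rintegral_gbarM.
  - by apply: bounded_meas_qhat => //; lia.
have x0 : 0 < 1 - (1 - rho) * gamma ^+ (2 ^ r.+1 - 1) by rewrite subr_gt0.
have gamma_ge1 : 1 <= gamma by rewrite ltW.
have rho'_ge0 : 0 <= 1 - rho by rewrite subr_ge0 ltW.
(* The smallness condition passes from [r.+1] to [r] because gamma >= 1; the hypothesis on [r]
   requires it. *)
have cr_lt1 : (1 - rho) * gamma ^+ (2 ^ r - 1) < 1.
  rewrite (le_lt_trans _ c_lt1)// ler_wpM2l// ler_weXn2l//.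
  by rewrite leq_sub2r// leq_exp2l.
have int_ge0 i h s : 0 <= \int[mu i]_x `|h x| ^+ s.
  by apply: Rintegral_ge0 => x _; exact: exprn_ge0.
elim: m j j1 => [|m ih] j j1 jmn.
  by rewrite addn0 qhat_id ler_peMl// deltaX_ge1.
rewrite addnS qhat_recl ?ltnS ?leq_addr// -addSn.
have j1n : (1 <= j.+1 <= n)%N by lia.
have jn : (j.+1 + m <= n)%N by lia.
set f1 := qhat mu K g j.+1 (j.+1 + m) f.
have bf1 : bounded_meas f1 by exact: bounded_meas_qhat.
have bG := bounded_meas_gbar j1n.
have step : \int[mu j]_x `|qhat_step mu K g j.+1 f1 x| ^+ (2 ^ r.+1) <=
    (1 - rho) * gamma ^+ (2 ^ r.+1 - 1) * \int[mu j.+1]_x `|f1 x| ^+ (2 ^ r.+1) +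
    rho * gamma ^+ (2 ^ r.+1 - 2) * (\int[mu j.+1]_x `|f1 x| ^+ (2 ^ r)) ^+ 2.
  apply: Rintegral_normX_step_le => //.
  - by apply: K_stationary; lia.
  - by move=> x; exact: gbar_ge0.
  - by move=> h bh; rewrite Rintegral_gbarM.
  - exact: gbar_le.
  - exact: ltW.
  - by apply: K_gap; lia.
rewrite (le_trans step)//.
have ih1 := ih _ (ltn0Sn j) jn.
(* The bound at exponent 2^r is squared, and the square of the mean of |f|^(2^r) is at most the mean
   of its square. *)
have ih2 : (\int[mu j.+1]_x `|f1 x| ^+ (2 ^ r)) ^+ 2 <=
    (delta gamma rho r ^+ (2 ^ r)) ^+ 2 *
    \int[mu (j.+1 + m)]_x `|f x| ^+ (2 ^ r.+1).
  have ihr1 := ihr m j.+1 cr_lt1 (ltn0Sn j) jn.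
  have D_ge0 : 0 <= delta gamma rho r ^+ (2 ^ r).
    by rewrite (le_trans ler01)// deltaX_ge1// subr_gt0.
  rewrite (le_trans (lerXn2r 2 _ _ ihr1)) ?nnegrE ?mulr_ge0//.
  rewrite exprMn; apply: ler_wpM2l; first exact: exprn_ge0.
  apply: (le_trans (sqr_Rintegral_le _ (bounded_meas_normX (2 ^ r) bf))).
  by under eq_Rintegral do rewrite -exprM -expnSr.
move: ih1 ih2; rewrite -/f1 deltaX_S//.
set c := (1 - rho) * gamma ^+ (2 ^ r.+1 - 1) in c_lt1 x0 *.
set G := gamma ^+ (2 ^ r.+1 - 2).
set D := (delta gamma rho r ^+ (2 ^ r)) ^+ 2.
set e := \int[mu (j.+1 + m)]_x `|f x| ^+ (2 ^ r.+1) => ih1 ih2.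
have c_ge0 : 0 <= c by rewrite mulr_ge0// exprn_ge0// (le_trans ler01).
have G_ge0 : 0 <= G by rewrite exprn_ge0// (le_trans ler01).
have e_ge0 : 0 <= e by exact: int_ge0.
have D_ge0 : 0 <= D by exact: sqr_ge0.
(* A = DG / (1 - c) is the fixed point of A = cA + DG: the first summand absorbs [ih1], the second
   [ih2] after bounding rho by 1. *)
rewrite (_ : D * G / (1 - c) * e = c * (D * G / (1 - c) * e) + G * (D * e)); last first.
  by field; rewrite gt_eqF.
apply: lerD; first exact: ler_wpM2l.
apply: (le_trans (ler_wpM2l _ ih2)); first exact: mulr_ge0.
rewrite -mulrA; apply: ler_piMl; last exact: ltW.
by rewrite mulr_ge0// mulr_ge0.
Qed.

End chain.
Unset Implicit Arguments.
Set Strict Implicit.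

(** * From p-th moments to L_p norms *)

Theorem corollary5p3 (R : realType) (E : polishType R) (n : nat)
  (mu : nat -> probability (borel E) R)
  (K : nat -> R.-pker (borel E) ~> (borel E))
  (g : nat -> borel E -> R)
  (gamma rho : R) (r p : nat)
  (K_stationary : forall k, (1 <= k <= n)%N -> stationary (mu k) (K k))
  (g_bounded : forall k, (1 <= k <= n)%N -> bounded_meas (g k))
  (g_gt0 : forall k, (1 <= k <= n)%N -> forall x, 0 < g k x)
  (mu_g : forall k, (1 <= k <= n)%N -> forall f, bounded_meas f ->
    \int[mu k]_x f x =
    (\int[mu k.-1]_x (g k x * f x)) / (\int[mu k.-1]_x g k x))
  (K_reversible : forall k, (1 <= k <= n)%N -> reversible (mu k) (K k))
  (gamma_gt1 : 1 < gamma)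
  (gbar_le : forall k, (1 <= k <= n)%N -> forall x, gbar mu g k x <= gamma)
  (p_def : p = (2 ^ r)%N)
  (rho_gt0 : 0 < rho) (rho_lt1 : rho < 1)
  (rho_gamma : (1 - rho) * gamma ^+ (p - 1) < 1)
  (K_gap : forall k, (1 <= k <= n)%N -> forall f, bounded_meas f ->
    (variance (mu k) (kernel_app (K k) f) <=
     (1 - rho)%:E * variance (mu k) f)%E) :
  (forall j k, (1 <= j)%N -> (j < k)%N -> (k <= n)%N ->
    forall f, bounded_meas f ->
    ('N[mu j]_(p%:R%:E)[EFin \o qhat mu K g j k f] <=
     (delta gamma rho r)%:E * 'N[mu k]_(p%:R%:E)[EFin \o f])%E) /\
  delta gamma rho r <
    gamma `^ (r%:R - 2 + 2 `^ (- (r%:R - 1))) /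
    (1 - (1 - rho) * gamma ^+ (2 ^ r - 1)).
Proof.
subst p; split; last by apply: delta_lt => //; rewrite subr_gt0.
move=> j k j1 jk kn f bf.
have p_gt0 : (0 < 2 ^ r)%N by rewrite expn_gt0.
have p_neq0 : (2 ^ r)%:R != 0 :> R by rewrite pnatr_eq0 -lt0n.
have [m kE] : exists m, k = (j + m)%N by exists (k - j)%N; rewrite subnKC// ltnW.
subst k.
have bq : bounded_meas (qhat mu K g j (j + m) f).
  exact: (bounded_meas_qhat _ g_bounded g_gt0 gbar_le).
have delta_ge0 : 0 <= delta gamma rho r.
  by apply: prodr_ge0 => i _; rewrite divr_ge0 ?powR_ge0.
have int_ge0 i h : 0 <= \int[mu i]_x `|h x| ^+ (2 ^ r).
  by apply: Rintegral_ge0 => x _; exact: exprn_ge0.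
rewrite (Lnorm_bounded_meas (mu j) p_gt0 bq) (Lnorm_bounded_meas _ p_gt0 bf).
rewrite -EFinM lee_fin.
(* With delta as the p-th root of its p-th power, both sides are p-th roots and monotonicity reduces
   the claim to moments. *)
have -> : delta gamma rho r = (delta gamma rho r ^+ (2 ^ r)) `^ (2 ^ r)%:R^-1.
  by rewrite -powR_mulrn// -powRrM mulfV// powRr1.
rewrite -powRM ?exprn_ge0//.
rewrite ge0_ler_powR ?nnegrE ?mulr_ge0 ?exprn_ge0//.
by apply: (@Rintegral_normX_qhat_le _ _ _ n) => //; exact: ltW.
Qed.
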